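(* Let $\mathcal{T}=(\mathcal{V},\mathcal{E})$ be a tree with vertex set $\mathcal{V}=\{1,\dots,d\}$, $d\ge 1$. Let $\boldsymbol{\lambda}=(\lambda_v)_{v\in\mathcal{V}}$ with $\lambda_v>0$ for all $v$, and let $\boldsymbol{\alpha}=(\alpha_e)_{e\in\mathcal{E}}$ satisfy $$\alpha_{(u,v)}\in\Big(0,\ \min\big(\sqrt{\lambda_u/\lambda_v},\sqrt{\lambda_v/\lambda_u}\big)\Big]\qquad\text{for every edge }(u,v)\in\mathcal{E}.$$ Choose a root $r\in\mathcal{V}$, and for $v\neq r$ let $\mathrm{pa}(v)$ be the parent of $v$ in $\mathcal{T}$ rooted at $r$. Let $(L_v)_{v\in\mathcal{V}}$ be independent random variables with $L_r\sim\mathrm{Poisson}(\lambda_r)$ and $$L_v\sim\mathrm{Poisson}\Big(\lambda_v\big(1-\alpha_{(\mathrm{pa}(v),v)}\sqrt{\lambda_{\mathrm{pa}(v)}/\lambda_v}\big)\Big),\qquad v\in\mathcal{V}\setminus\{r\}.$$ Define $\boldsymbol{N}=(N_v)_{v\in\mathcal{V}}$ recursively from the root by $N_r=L_r$ and $$N_v=\Big(\alpha_{(\mathrm{pa}(v),v)}\sqrt{\lambda_v/\lambda_{\mathrm{pa}(v)}}\Big)\circ N_{\mathrm{pa}(v)}+L_v,\qquad v\in\mathcal{V}\setminus\{r\},$$ where $\circ$ denotes binomial thinning. Then: (1) $\boldsymbol{N}$ is a Markov random field with respect to $\mathcal{T}$; (2) the joint distribution of $\boldsymbol{N}$ is the same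 whichever root $r\in\mathcal{V}$ is chosen; (3) $N_v\sim\mathrm{Poisson}(\lambda_v)$ for every $v\in\mathcal{V}$.
   Context: Edges are undirected, so $\alpha_{(u,v)}=\alpha_{(v,u)}$. A tree is a connected simple undirected graph without cycles. Binomial thinning: for an $\mathbb{N}$-valued random variable $Y$ and $\theta\in[0,1]$, $\theta\circ Y:=\sum_{j=1}^{Y}I_j^{(\theta)}$, where $(I_j^{(\theta)})_{j\ge1}$ is a sequence of independent Bernoulli($\theta$) random variables independent of $Y$ (an empty sum is $0$). In the recursive construction of $\boldsymbol{N}$, the Bernoulli sequences used at different vertices are mutually independent and independent of $(L_v)_{v\in\mathcal{V}}$. A Poisson distribution with parameter $0$ is the point mass at $0$. A random vector $\boldsymbol{X}=(X_v)_{v\in\mathcal{V}}$ is a Markov random field (MRF) with respect to a graph $(\mathcal{V},\mathcal{E})$ if for any two distinct $u,w\in\mathcal{V}$ with $(u,w)\notin\mathcal{E}$, $X_u$ and $X_w$ are conditionally independent given $\{X_j:(u,j)\in\mathcal{E}\}$. *)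

(* Defs.v *)
From HB Require Import structures.
From mathcomp Require Import all_boot all_order all_algebra.
From mathcomp Require Import all_classical all_reals all_analysis.

Set Implicit Arguments.
Unset Strict Implicit.
Unset Printing Implicit Defensive.

Import Order.TTheory GRing.Theory Num.Theory.

Local Open Scope classical_set_scope.
Local Open Scope ring_scope.

Definition is_acyclic (V : finType) (e : rel V) : Prop :=
  forall c : seq V, (2 < size c)%N -> ~ (cycle e c /\ uniq c).

Definition is_tree (V : finType) (e : rel V) : Prop :=
  [/\ irreflexive e, symmetric e,
      forall u v, connect e u v
    & is_acyclic e].

(* [u] is the vertex just before [v] on a simple path
   [r, p_1, ..., p_k = u, v]; for [k = 0] the parent [u] is [r] itself.
   No [u] is a parent of [r]. *)
Definition is_parent (V : finType) (e : rel V) (r u v : V) : Prop :=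
  exists p : seq V,
    [/\ path e r (rcons p v), uniq (r :: rcons p v) & u = last r p].

(* The [nat] argument of [poisson_prob] is a dummy.  For a rate that is not
   positive, [poisson_prob] is the point mass at 0. *)
Notation poisson rate := (poisson_prob rate 0%N).

Section probability.
Context {d : measure_display} {T : measurableType d} {R : realType}.
Variable P : probability T R.

Definition mutually_independent (J : eqType) (D : {pred J})
    (F : J -> set (set T)) : Prop :=
  forall (s : seq J) (E : J -> set T),
    uniq s -> {subset s <= D} -> (forall i, i \in s -> F i (E i)) ->
    P (\bigcap_(i in [set` s]) E i) = (\prod_(i <- s) P (E i))%E.

Definition cond_prob (A C : set T) : R := fine (P (A `&` C)) / fine (P C).

(* [Z] takes countably many values, so conditioning on [Z] is conditioning on
   the events [Z = z] of positive probability. *)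
Definition cond_independent d1 d2 (T1 : measurableType d1)
    (T2 : measurableType d2) (U : countType)
    (X : {RV P >-> T1}) (Y : {RV P >-> T2}) (Z : T -> U) : Prop :=
  forall (z : U) (A : set T1) (B : set T2),
    measurable A -> measurable B -> (0 < P (Z @^-1` [set z]))%E ->
    cond_prob (X @^-1` A `&` Y @^-1` B) (Z @^-1` [set z]) =
    cond_prob (X @^-1` A) (Z @^-1` [set z]) *
    cond_prob (Y @^-1` B) (Z @^-1` [set z]).

Definition joint (J : finType) (X : J -> {RV P >-> nat}) (t : T) :
  {ffun J -> nat} := [ffun j => X j t].

Definition is_MRF (V : finType) (e : rel V) (X : V -> {RV P >-> nat}) : Prop :=
  forall u w : V, u != w -> ~~ e u w ->
    cond_independent (X u) (X w)
      (joint (fun j : {j : V | e u j} => X (val j))).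

(* Binomial thinning of [Y] when [I] is an iid Bernoulli sequence independent
   of [Y]. *)
Definition thinning (I : nat -> {RV P >-> bool}) (Y : {RV P >-> nat}) (t : T) :
  nat := (\sum_(j < Y t) I j t)%N.

End probability.

(* Equality of laws for vectors living on possibly different spaces; the value
   type is countable, so all its subsets are events. *)
Definition same_joint_law (R : realType) (V : finType)
    (d1 d2 : measure_display) (T1 : measurableType d1) (T2 : measurableType d2)
    (P1 : probability T1 R) (P2 : probability T2 R)
    (X1 : V -> {RV P1 >-> nat}) (X2 : V -> {RV P2 >-> nat}) : Prop :=
  forall A : set {ffun V -> nat},
    P1 (joint X1 @^-1` A) = P2 (joint X2 @^-1` A).

(* [I v j] is the [j]-th Bernoulli variable used at the vertex [v]; the
   variables [I r j] are not used, and nothing is assumed about them. *)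
Record rooted_construction (R : realType) (V : finType) (e : rel V)
    (lambda : V -> R) (alpha : V -> V -> R) (r : V)
    (d : measure_display) (T : measurableType d) (P : probability T R)
    (L : V -> {RV P >-> nat}) (I : V -> nat -> {RV P >-> bool})
    (N : V -> {RV P >-> nat}) : Prop := {
  rc_indep : mutually_independent P
    [pred i : V + V * nat | if i is inr vj then vj.1 != r else true]
    (fun i => match i with
              | inl v => g_sigma_algebra_preimage (L v)
              | inr vj => g_sigma_algebra_preimage (I vj.1 vj.2)
              end) ;
  rc_L_root : forall A : set nat,
    distribution P (L r) A = poisson (lambda r) A ;
  rc_L : forall u v : V, is_parent e r u v -> forall A : set nat,
    distribution P (L v) A =
    poisson (lambda v * (1 - alpha u v * Num.sqrt (lambda u / lambda v))) A ;
  rc_I : forall u v : V, is_parent e r u v -> forall (j : nat) (A : set bool),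
    distribution P (I v j) A =
    bernoulli_prob (alpha u v * Num.sqrt (lambda v / lambda u)) A ;
  rc_N_root : forall t : T, N r t = L r t ;
  rc_N : forall u v : V, is_parent e r u v -> forall t : T,
    N v t = (thinning (I v) (N u) t + L v t)%N
}.

(* Main.v *)
(* Put c_uv = alpha_uv sqrt(lambda_u lambda_v), so that c_uv <= lambda_u and
   c_uv <= lambda_v.  Unfolding the recursion from the root r turns {N = x} into
   an intersection of events about disjoint blocks of the independent variables,
   so its probability is p(x) = prod_v K_v(x_pa(v), x_v), where K_v(m, .) is the
   law of thinning m plus L_v.

   If pi_l is the Poisson mass function of rate l, then the mass
   pi_{lambda_u}(m) K_v(m, n), where u = pa(v), is that of (Z + X, Z + Y) with
   Z, X, Y independent Poisson of rates c_uv, lambda_u - c_uv, lambda_v - c_uv,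
   which is symmetric in the two ends of the edge.  Hence the marginals are
   Poisson, by induction from the root; and p(x) is the product of all
   pi_{lambda_v}(x_v) and of an unoriented density for each edge, which does not
   involve the root.

   For the Markov property, let x and y agree on the neighbours of u.
   Exchanging the values x_u and y_u does not change p(x) p(y), because each
   factor K_v involves only one edge.  Summing over the pairs (x, y) gives
   P(X_u in A, F) P(G) = P(X_u in A, G) P(F) for events F, G that fix the values
   of the neighbours of u and do not otherwise depend on X_u. *)

Require Import Defs.
From HB Require Import structures.
From mathcomp Require Import all_boot all_order all_algebra.
From mathcomp Require Import all_classical all_reals all_analysis.
From mathcomp Require Import zify ring.

Set Implicit Arguments.
Unset Strict Implicit.
Unset Printing Implicit Defensive.

Import Order.TTheory GRing.Theory Num.Theory.

Local Open Scope classical_set_scope.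
Local Open Scope ring_scope.

(** * Simple paths in trees *)

Section tree.
Variables (V : finType) (e : rel V).
Hypothesis he : is_tree e.

Let irr : irreflexive e. Proof. by case: he. Qed.
Let sym : symmetric e. Proof. by case: he. Qed.

Lemma tree_simple_path_unique (r : V) (p q : seq V) :
  path e r p -> uniq (r :: p) -> path e r q -> uniq (r :: q) ->
  last r p = last r q -> p = q.
Proof.
have [_ _ _ acyc] := he.
elim: p r q => [|a p IH] r [|b q] //=.
- by move=> _ _ _ /andP[rq _] E; rewrite E mem_last in rq.
- by move=> _ /andP[rp _] _ _ E; rewrite -E mem_last in rp.
move=> /andP[ra pp] /andP[rp up] /andP[rb pq] /andP[rq uq] E.
have [ab|ab] := eqVneq a b.
  by subst b; rewrite (IH a q).
(* Two distinct first steps: joining the tails avoids [r] and closes a cycle. *)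
exfalso.
have W : path e a (p ++ rev (belast b q)).
  rewrite cat_path pp /= E rev_path (@eq_path _ _ e) // => x y; exact: sym.
have Wl : last a (p ++ rev (belast b q)) = b.
  rewrite last_cat; move: E; case: (q) => [|c q'] //= _.
  by rewrite rev_cons last_rcons.
have Ws : {subset a :: p ++ rev (belast b q) <= (a :: p) ++ (b :: q)}.
  move=> x; rewrite -cat_cons !mem_cat mem_rev => /orP[->//|/mem_belast ->].
  by rewrite orbT.
(* The tails may meet, so the walk from [a] to [b] can repeat vertices. It is shortened to a simple
   path, which still avoids [r]. *)
case: (shortenP W) Wl => s ps us ss ls.
have rs : r \notin a :: s.
  apply/negP => rs; have : r \in (a :: p) ++ (b :: q).
    apply: Ws; move: rs; rewrite !inE => /orP[->//|/ss ->].
    by rewrite orbT.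
  by rewrite mem_cat (negPf rp) (negPf rq).
(* As [a] and [b] differ, [s] is not empty, and the cycle has at least three vertices. *)
case: s ps us ls rs {ss} => [|c s] ps us ls rs; first by rewrite -ls eqxx in ab.
apply: (acyc [:: r, a, c & s]) => //; split; last by rewrite /= rs.
rewrite /cycle rcons_path -[path _ _ _]/(e r a && path e a (c :: s)) ra ps.
by rewrite /= in ls; rewrite /= ls sym rb.
Qed.

Lemma parent_exists (r v : V) : v != r -> exists u, is_parent e r u v.
Proof.
have [_ _ con _] := he; move=> vr.
have /connectP[p pp lp] := con r v.
case: (shortenP pp) lp => p' pp' up' _.
case: (lastP p') pp' up' => [|q w] pp' up' lp.
  by rewrite lp eqxx in vr.
by rewrite last_rcons in lp; subst w; exists (last r q), q.
Qed.

Lemma parent_edge (r u v : V) : is_parent e r u v -> e u v.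
Proof. by move=> [p [+ _ ->]]; rewrite rcons_path => /andP[]. Qed.

Lemma parent_unique (r u u' v : V) :
  is_parent e r u v -> is_parent e r u' v -> u = u'.
Proof.
move=> [p [pp up ->]] [q [pq uq ->]].
suff /rcons_inj[->] : rcons p v = rcons q v by [].
by apply: (@tree_simple_path_unique r) => //; rewrite !last_rcons.
Qed.

Lemma root_no_parent (r u : V) : ~ is_parent e r u r.
Proof. by move=> [p [_ + _]]; rewrite /= mem_rcons inE eqxx. Qed.

(** By uniqueness of simple paths, the path to [u] and the path to [v] would each extend the other
    by one vertex. *)
Lemma parent_asym (r u v : V) : is_parent e r u v -> ~ is_parent e r v u.
Proof.
move=> [p [pp up lp]] [q [pq uq lq]].
have pp1 : path e r p by move: pp; rewrite rcons_path => /andP[].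
have up1 : uniq (r :: p) by move: up; rewrite -rcons_cons rcons_uniq => /andP[].
have pq1 : path e r q by move: pq; rewrite rcons_path => /andP[].
have uq1 : uniq (r :: q) by move: uq; rewrite -rcons_cons rcons_uniq => /andP[].
have E1 : p = rcons q u.
  by apply: (@tree_simple_path_unique r) => //; rewrite last_rcons.
have E2 : q = rcons p v.
  by apply: (@tree_simple_path_unique r) => //; rewrite last_rcons.
by have := congr1 size E1; rewrite E2 !size_rcons; lia.
Qed.

Lemma edge_parent (r u v : V) :
  e u v -> is_parent e r u v \/ is_parent e r v u.
Proof.
have [_ _ con acyc] := he; move=> uv.
have /connectP[p0 pp0 lp0] := con r u.
case: (shortenP pp0) lp0 => p pp up _ lp.
have [vp|vp] := boolP (v \in r :: p); last first.
  left; exists p; split => //.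
    by rewrite rcons_path pp -lp uv.
  by rewrite -rcons_cons rcons_uniq vp.
right; case/splitPl: vp pp up lp => p1 p2 l1.
rewrite cat_path l1 -cat_cons cat_uniq last_cat l1.
move=> /andP[pp1 pp2] /and3P[up1 np up2] lp.
(* [p2] leads from [v] to [u]. If empty, the edge is a loop; with one step, [v] is the parent of
   [u]; with more, the edge closes it to a cycle. *)
case: p2 np pp2 up2 lp => [|a [|b s]] np pp2 up2 /= lp.
- by rewrite lp irr in uv.
- exists p1; split => //.
    by rewrite rcons_path pp1 l1 sym uv.
  by rewrite -rcons_cons rcons_uniq up1 andbT lp; move: np; rewrite /= orbF.
- exfalso; apply: (acyc [:: v, a, b & s]) => //; split.
    by rewrite /cycle rcons_path pp2 /= -lp.
  rewrite cons_uniq up2 andbT; apply/negP => vs.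
  move/negP: np; apply; apply/hasP; exists v => //.
  by rewrite -l1; exact: mem_last.
Qed.

Lemma simple_path_exists (r v : V) : exists p : seq V,
  [/\ path e r p, uniq (r :: p) & last r p = v].
Proof.
have [_ _ con _] := he.
have /connectP[p0 pp0 lp0] := con r v.
by case: (shortenP pp0) lp0 => p pp up _ lp; exists p.
Qed.

Lemma parent_ind (r : V) (Q : V -> Prop) :
  Q r -> (forall u v, is_parent e r u v -> Q u -> Q v) -> forall v, Q v.
Proof.
move=> Qr QS v; have [p [+ + <-]] := simple_path_exists r v.
elim/last_ind: p => [|p w IH] // pp up.
rewrite last_rcons; apply: (QS (last r p)); first by exists p.
apply: IH; first by move: pp; rewrite rcons_path => /andP[].
by move: up; rewrite -rcons_cons rcons_uniq => /andP[].
Qed.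

End tree.
(** * Poisson mass functions *)

Section poisson_algebra.
Context {R : realType}.
Implicit Types (a b c p q mu theta : R) (k m n : nat).

(* [0 ^+ 0 = 1] makes this the mass function also for rate [0]. *)
Definition pois mu k : R := mu ^+ k / k`!%:R * expR (- mu).

Lemma pois_ge0 mu k : 0 <= mu -> 0 <= pois mu k.
Proof.
by move=> mu0; rewrite mulr_ge0 ?expR_ge0// divr_ge0 ?exprn_ge0.
Qed.

Lemma pois_gt0 mu k : 0 < mu -> 0 < pois mu k.
Proof.
by move=> mu0; rewrite mulr_gt0 ?expR_gt0// divr_gt0 ?exprn_gt0.
Qed.

Lemma poisson_prob_set1 mu k : 0 <= mu ->
  poisson mu [set k] = (pois mu k)%:E.
Proof.
move=> mu0; rewrite /poisson_prob; case: ifPn => [mu1|].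
  by rewrite esum_set1 ?lee_fin ?poisson_pmf_ge0// /poisson_pmf mu1.
rewrite -leNgt => mu1; have -> : mu = 0 by apply/eqP; rewrite eq_le mu1.
rewrite /pois oppr0 expR0 mulr1 diracE.
case: k => [|k]; first by rewrite mem_set// expr0 divr1.
by rewrite memNset// expr0n !mul0r.
Qed.

(** Additivity of Poisson rates, which is the binomial theorem once factorials are cleared. The
    summands are commuted because [exprDn] gives the exponent [k] to the second one. *)
Lemma pois_conv p q n :
  \sum_(k < n.+1) pois p k * pois q (n - k) = pois (p + q) n.
Proof.
rewrite /pois (addrC p) exprDn 2!mulr_suml; apply: eq_bigr => k _.
have kn : (k <= n)%N by rewrite -ltnS.
have -> : expR (- (q + p)) = expR (- p) * expR (- q).
  by rewrite -expRD; congr expR; ring.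
rewrite -(bin_fact kn) !natrM -mulr_natr; field.
by rewrite !pnatr_eq0 -!lt0n !fact_gt0 bin_gt0 kn.
Qed.

(** Poisson splitting: of [n] points [k] are kept and the others discarded, and the two counts are
    independent. *)
Lemma pois_thin mu theta n k : (k <= n)%N ->
  pois mu n * ('C(n, k)%:R * theta ^+ k * (1 - theta) ^+ (n - k)) =
  pois (mu * theta) k * pois (mu - mu * theta) (n - k).
Proof.
move=> kn; rewrite /pois.
have -> : mu - mu * theta = mu * (1 - theta) by ring.
rewrite !exprMn.
have -> : expR (- mu) = expR (- (mu * theta)) * expR (- (mu * (1 - theta))).
  by rewrite -expRD; congr expR; ring.
have -> : mu ^+ n = mu ^+ k * mu ^+ (n - k) by rewrite -exprD subnKC.
rewrite -(bin_fact kn) !natrM; field.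
by rewrite !pnatr_eq0 -!lt0n !fact_gt0 bin_gt0 kn.
Qed.

(** Moves [n] from the range into a condition, so that a sum over [n] can be exchanged with this
    one. *)
Lemma sum_minn (F : nat -> R) m n :
  \sum_(k < (minn m n).+1) F k = \sum_(k < m.+1 | (k <= n)%N) F k.
Proof.
rewrite (big_ord_widen m.+1) ?ltnS ?geq_minl//; apply: eq_bigl => k.
by rewrite ltnS leq_min -ltnS ltn_ord.
Qed.

(* Mass function of [theta o n + L], with [L] Poisson of rate [mu]. *)
Definition thin_kernel theta mu n m : R :=
  \sum_(k < (minn n m).+1)
    'C(n, k)%:R * theta ^+ k * (1 - theta) ^+ (n - k) * pois mu (m - k).

(* Mass function of [(Z + X, Z + Y)], for independent Poisson variables [Z],
   [X], [Y] of rates [c], [p], [q]. *)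
Definition edge_pmf c p q m n : R :=
  \sum_(k < (minn m n).+1) pois c k * pois p (m - k) * pois q (n - k).

Lemma edge_pmfC c p q m n : edge_pmf c p q m n = edge_pmf c q p n m.
Proof. by rewrite /edge_pmf (minnC n m); apply: eq_bigr => k _; ring. Qed.

Lemma edge_pmf_ge0 c p q m n : 0 <= c -> 0 <= p -> 0 <= q ->
  0 <= edge_pmf c p q m n.
Proof.
move=> c0 p0 q0; apply: sumr_ge0 => k _.
exact: (mulr_ge0 (mulr_ge0 (pois_ge0 _ c0) (pois_ge0 _ p0)) (pois_ge0 _ q0)).
Qed.

(** By Poisson splitting, the points kept by the thinning form the shared variable Z, the discarded
    ones form X, and the innovation is Y. *)
Lemma pois_thin_kernel a b theta m n :
  pois a m * thin_kernel theta b m n =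
  edge_pmf (a * theta) (a - a * theta) b m n.
Proof.
rewrite /thin_kernel /edge_pmf mulr_sumr; apply: eq_bigr => k _.
rewrite mulrA pois_thin// (leq_trans _ (geq_minl m n))//.
by rewrite -ltnS.
Qed.

End poisson_algebra.
(** * Measures and sums over countable types *)

Section countable_sums.
Local Open Scope ereal_scope.

Lemma esumZl (R : realType) (T : choiceType) (A : set T) (c : R)
    (f : T -> \bar R) : (0 <= c)%R -> (forall x, 0 <= f x) ->
  \esum_(x in A) (c%:E * f x) = c%:E * \esum_(x in A) f x.
Proof.
move=> c0 f0; rewrite /esum -ereal_supZl//; last first.
  by apply/set0P; exists 0, set0; [exact: fsets_set0|rewrite fsbig_set0].
congr ereal_sup; rewrite image_comp; congr image; apply/funext => B /=.
by rewrite ge0_mule_fsumr.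
Qed.

Lemma measurable_preimage_fibers d (T : measurableType d) (U : countType)
    (g : T -> U) (A : set U) :
  (forall x, measurable (g @^-1` [set x])) -> measurable (g @^-1` A).
Proof.
move=> mg.
have -> : g @^-1` A = \bigcup_(x in A) g @^-1` [set x].
  apply/seteqP; split => t; first by move=> At; exists (g t).
  by move=> [x Ax /= gx]; rewrite /= gx.
rewrite bigcup_mkcond; apply: countable_bigcupT_measurable => // x.
by case: ifP.
Qed.

Lemma measurable_ffun_fibers d (T : measurableType d) (J : finType)
    (U : countType) (g : J -> T -> U) :
  (forall j x, measurable (g j @^-1` [set x])) ->
  forall x, measurable ((fun t => [ffun j => g j t]) @^-1` [set x]).
Proof.
move=> mg x.
have -> : (fun t => [ffun j => g j t]) @^-1` [set x] =
    \bigcap_(j in [set: J]) g j @^-1` [set x j].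
  apply/seteqP; split => t /= => [Et j _|H]; first by rewrite /= -Et ffunE.
  by apply/ffunP => j; rewrite ffunE; exact: H.
by apply: fin_bigcap_measurable.
Qed.

Lemma measure_fibers d (T : measurableType d) (R : realType)
    (mu : {measure set T -> \bar R}) (U : countType) (g : T -> U) (E : set T)
    (A : set U) :
  measurable E -> (forall x, measurable (g @^-1` [set x])) ->
  mu (E `&` g @^-1` A) = \esum_(x in A) mu (E `&` g @^-1` [set x]).
Proof.
(* Coding [U] in [nat] makes the fibres a sequence of disjoint sets, as countable additivity
   requires. *)
move=> mE mg; pose F n := E `&` (pickle \o g) @^-1` [set n].
have FE x : F (pickle x) = E `&` g @^-1` [set x].
  congr (_ `&` _); apply/seteqP; split => t /= => [|->//].
  exact: (pcan_inj pickleK).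
transitivity (mu (\bigcup_(n in pickle @` A) F n)).
  congr (mu _); apply/seteqP; split => t.
    by move=> [Et At]; exists (pickle (g t)) => //; exists (g t).
  move=> [_ [x Ax <-]]; rewrite FE => -[Et /= gt].
  by split => //=; rewrite gt.
rewrite measure_bigcup.
- rewrite nneseries_esum; last by move=> n _; exact: measure_ge0.
  rewrite set_mem_set esum_image; last first.
    by move=> x y _ _; exact: (pcan_inj pickleK).
  by apply: eq_esum => x _; rewrite FE.
- by move=> _ [x _ <-]; rewrite FE; exact: measurableI.
- move=> i j _ _ [t [[_ /= <-] [_ /= <-]]]; reflexivity.
Qed.

Lemma esum_finType (R : realType) (J : finType) (f : J -> \bar R) :
  (forall x, 0 <= f x) -> \esum_(x in [set: J]) f x = \sum_x f x.
Proof.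
move=> f0; have fJ : finite_set [set: J] by [].
rewrite esum_fset// fsbig_finite//=.
rewrite -big_enum; apply: perm_big.
apply: uniq_perm; rewrite ?enum_uniq ?finmap.fset_uniq//.
by move=> x; rewrite in_fset_set// mem_enum in_setT.
Qed.

Lemma esum_poisE (R : realType) (mu : R) (A : set nat) : (0 <= mu)%R ->
  poisson mu A = \esum_(k in A) (pois mu k)%:E.
Proof.
move=> mu0; have := measure_fibers (poisson mu) (g := id) A measurableT.
rewrite setTI => -> //.
by apply: eq_esum => k _; rewrite setTI -poisson_prob_set1.
Qed.

(** Summing out the first coordinate Z + X leaves Z + Y: for fixed Z = k the masses of X add up to
    1, and [pois_conv] sums over [k]. *)
Lemma esum_edge_pmf (R : realType) (c p q : R) (n : nat) :
  (0 <= c)%R -> (0 <= p)%R -> (0 <= q)%R ->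
  \esum_(m in [set: nat]) (edge_pmf c p q m n)%:E = (pois (c + q) n)%:E.
Proof.
move=> c0 p0 q0.
transitivity (\esum_(m in [set: nat]) \sum_(k < n.+1)
    ((pois c k * pois q (n - k))%:E *
     (if (k <= m)%N then pois p (m - k) else 0%R)%:E)).
  apply: eq_esum => m _; rewrite edge_pmfC /edge_pmf.
  rewrite (sum_minn (fun k => pois c k * pois q (n - k) * pois p (m - k))%R).
  rewrite -sumEFin big_mkcond; apply: eq_bigr => k _.
  by case: ifP => _; rewrite ?mule0.
have if_ge0 k m : 0 <= (if (k <= m)%N then pois p (m - k) else 0%R)%:E.
  by rewrite lee_fin; case: ifP => // _; exact: pois_ge0.
rewrite esum_sum; last first.
  by move=> m k _ _; rewrite mule_ge0// lee_fin mulr_ge0 ?pois_ge0.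
rewrite -pois_conv -sumEFin; apply: eq_bigr => k _.
rewrite esumZl; [|by rewrite mulr_ge0 ?pois_ge0|exact: if_ge0].
suff -> : \esum_(m in [set: nat])
    (if (k <= m)%N then pois p (m - k) else 0%R)%:E = 1 by rewrite mule1.
transitivity (poisson p setT); last first.
  exact: (@probability_setT _ _ _ (poisson p)).
rewrite esum_poisE//.
(* The terms with m < k vanish; the others are reindexed by m = k + i. *)
transitivity (\esum_(m in [set addn k i | i in [set: nat]])
    (pois p (m - k))%:E); last first.
  rewrite esum_image => [|i j _ _ /addnI//].
  by apply: eq_esum => i _; rewrite addKn.
rewrite [RHS]esum_mkcond; apply: eq_esum => m _.
case: ifP => [km|km].
  by rewrite ifT// inE; exists (m - k)%N => //; rewrite subnKC.
rewrite ifF//; apply/negP; rewrite inE => -[i _ E].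
by rewrite -E leq_addr in km.
Qed.

End countable_sums.
(** * Blocks of independent variables *)

Section blocks.
Context (R : realType) (V : finType) (r : V).
Context (d : measure_display) (T : measurableType d) (P : probability T R).
Variables (L : V -> {RV P >-> nat}) (I : V -> nat -> {RV P >-> bool}).
Variables (theta mu : V -> R).
Hypothesis indep : mutually_independent P
    [pred i : V + V * nat | if i is inr vj then vj.1 != r else true]
    (fun i => match i with
              | inl v => g_sigma_algebra_preimage (L v)
              | inr vj => g_sigma_algebra_preimage (I vj.1 vj.2)
              end).
Hypothesis law_L : forall v k, P (L v @^-1` [set k]) = (pois (mu v) k)%:E.
Hypothesis law_I : forall v j b, v != r ->
  P (I v j @^-1` [set b]) = (if b then theta v else 1 - theta v)%:E.

Lemma measurable_preimage_nat (X : {RV P >-> nat}) (A : set nat) :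
  measurable (X @^-1` A).
Proof. by rewrite -[X in measurable X]setTI; apply: measurable_funP. Qed.

Lemma measurable_preimage_bool (X : {RV P >-> bool}) (A : set bool) :
  measurable (X @^-1` A).
Proof. by rewrite -[X in measurable X]setTI; apply: measurable_funP. Qed.

(** Only finitely many independent variables are prescribed, so the probability factorizes. [f v] is
    the set of successes at [v], and [n r = 0] keeps the variables [I r j] out of the event. *)
Lemma pattern_law (S : {set V}) (M : nat) (n l : V -> nat)
    (f : V -> {set 'I_M}) : n r = 0%N ->
  P [set t | forall v, v \in S -> L v t = l v /\
       forall j : 'I_M, (j < n v)%N -> I v j t = (j \in f v)] =
  (\prod_(v in S) (pois (mu v) (l v) *
     \prod_(j < M | (j < n v)%N)
        (if j \in f v then theta v else 1 - theta v)))%:E.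
Proof.
move=> nr.
(* The indicator of [f v], extended to all of [nat] because [E] is indexed by all the variables. *)
pose b v (j : nat) := [exists i in f v, (i : nat) == j].
have bE v (j : 'I_M) : b v j = (j \in f v).
  apply/existsP/idP => [[i /andP[fi /eqP/val_inj <-]] //|fj].
  by exists j; rewrite fj /=.
pose E (i : V + V * nat) := match i with
  | inl v => L v @^-1` [set l v]
  | inr vj => I vj.1 vj.2 @^-1` [set b vj.1 vj.2] end.
pose s1 : seq (V + V * nat) := [seq inl v | v <- enum S].
pose s2 : seq (V + V * nat) :=
  [seq inr (v, val j) | v <- enum S, j <- enum [pred j : 'I_M | (j < n v)%N]].
have s2P i : i \in s2 -> exists v (j : 'I_M),
    [/\ v \in S, (j < n v)%N & i = inr (v, val j)].
  move=> /allpairsPdep[v [j [vS jn ->]]]; exists v, j; split => //.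
    by rewrite mem_enum in vS.
  by rewrite mem_enum in jn.
have nr0 v j : (j < n v)%N -> v != r.
  by apply: contraTneq => ->; rewrite nr.
have := indep (s := s1 ++ s2) (E := E); rewrite big_cat /= => H.
transitivity (P (\bigcap_(i in [set` s1 ++ s2]) E i)).
  congr (P _); apply/seteqP; split => t /=.
    move=> Ht i /=; rewrite mem_cat.
    move=> /orP[/mapP[v vS ->]|/s2P[v [j [vS jn ->]]]].
      by rewrite mem_enum in vS; have [] := Ht v vS.
    by have [_ /(_ j jn)] := Ht v vS; rewrite /= bE.
  move=> Ht v vS; split.
    apply: (Ht (inl v)); rewrite /= mem_cat map_f//.
    by rewrite mem_enum.
  move=> j jn; rewrite -bE; apply: (Ht (inr (v, val j))).
  rewrite /= mem_cat; apply/orP; right; apply/allpairsPdep.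
  by exists v, j; rewrite !mem_enum.
rewrite H; first last.
- move=> i; rewrite mem_cat => /orP[/mapP[v vS ->]|/s2P[v [j [vS jn ->]]]] /=.
    by exists [set l v] => //; rewrite setTI.
  by exists [set b v j] => //; rewrite setTI.
- move=> i; rewrite mem_cat => /orP[/mapP[v vS ->//]|/s2P[v [j [vS jn ->]]]].
  by rewrite inE /= (nr0 _ _ jn).
- rewrite cat_uniq map_inj_uniq ?enum_uniq; last by move=> ? ? [].
  apply/andP; split=> //; apply/andP; split.
    by apply/hasPn => i /s2P[v [j [_ _ ->]]]; apply/negP => /mapP[].
  apply: allpairs_uniq_dep => //; rewrite ?enum_uniq//.
    by move=> v _; exact: enum_uniq.
  by move=> [v j] [v' j'] _ _ /= [-> /val_inj ->].
rewrite big_map big_allpairs_dep /= !big_enum /= -big_split /= -prodEFin.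
apply: eq_bigr => v vS; rewrite EFinM -law_L -prodEFin big_enum /=.
congr (_ * _)%E; apply: eq_bigr => j jn.
by rewrite law_I ?bE//; exact: nr0 jn.
Qed.

Lemma thin_kernel_subsets (M n m : nat) (th nu : R) : (n <= M)%N ->
  \sum_(B : {set 'I_M} |
      (B \subset [set j : 'I_M | (j < n)%N]%SET) && (#|B| <= m)%N)
     (pois nu (m - #|B|) *
      \prod_(j < M | (j < n)%N) (if j \in B then th else 1 - th)) =
  thin_kernel th nu n m.
Proof.
move=> nM; set A := [set j : 'I_M | (j < n)%N]%SET.
have cA : #|A| = n.
  rewrite -sum1_card (eq_bigl (fun j : 'I_M => (j < n)%N)) => [|j];
    last by rewrite inE.
  by rewrite -(big_ord_widen M (fun=> 1%N) nM) sum1_card card_ord.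
have prodE (B : {set 'I_M}) : B \subset A ->
    \prod_(j < M | (j < n)%N) (if j \in B then th else 1 - th) =
    th ^+ #|B| * (1 - th) ^+ (n - #|B|).
  move=> BA; rewrite (bigID (fun j => j \in B)) /=; congr (_ * _).
    rewrite (eq_bigl (fun j => j \in B)) => [|j].
      by rewrite (eq_bigr (fun=> th)) ?prodr_const// => j /= ->.
    rewrite /=; apply/andP/idP => [[]//|jB]; split => //.
    by have /fintype.subsetP/(_ _ jB) := BA; rewrite inE.
  rewrite (eq_bigl (fun j => j \in (A :\: B)%SET)) => [|j];
    last by rewrite !inE andbC.
  rewrite (eq_bigr (fun=> 1 - th)) => [|j];
    last by rewrite !inE => /andP[/negPf->].
  by rewrite prodr_const cardsD (finset.setIidPr BA) cA.
(* The success sets are grouped by their size [k]; there are C(n, k) of each size. *)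
rewrite (partition_big (fun B : {set 'I_M} => inord #|B| : 'I_n.+1)
           (fun k => (k <= m)%N)) => [|B /andP[BA Bm]]; last first.
  by rewrite inordK// ltnS -cA subset_leq_card.
rewrite /thin_kernel (sum_minn (fun k =>
  'C(n, k)%:R * th ^+ k * (1 - th) ^+ (n - k) * pois nu (m - k))).
apply: eq_bigr => k km.
pose Bk := [set B : {set 'I_M} | B \subset A & #|B| == k]%SET.
rewrite (eq_bigl (fun B => B \in Bk)); last first.
  move=> B; rewrite !inE.
  apply/andP/andP => [[/andP[BA Bm] /eqP<-]|[BA /eqP E]].
    by split => //; rewrite inordK// ltnS -cA subset_leq_card.
  split; first by rewrite BA E.
  by rewrite E inord_val.
rewrite (eq_bigr (fun=> pois nu (m - k) * (th ^+ k * (1 - th) ^+ (n - k)))).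
  by rewrite sumr_const cards_draws cA -mulr_natl; ring.
by move=> B; rewrite !inE => /andP[BA /eqP cB]; rewrite prodE// cB.
Qed.

Lemma sum_bool_card (M n : nat) (B : nat -> bool) : (n <= M)%N ->
  (\sum_(j < n) B j)%N = #|[set j : 'I_M | (j < n)%N && B j]%SET|.
Proof.
move=> nM; rewrite (big_ord_widen M (fun j => nat_of_bool (B j)) nM).
rewrite -sum1_card big_mkcond [RHS]big_mkcond; apply: eq_bigr => j _.
by rewrite inE; case: ltnP => //= _; case: (B j).
Qed.

(** The event is split according to the success sets at all vertices. Each piece is a pattern, and
    distributivity turns the sum over families of sets into a product over vertices of sums over
    sets. *)
Lemma block_law (S : {set V}) (n m : V -> nat) : n r = 0%N ->
  P [set t | forall v, v \in S ->
       (\sum_(j < n v) I v j t + L v t)%N = m v] =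
  (\prod_(v in S) thin_kernel (theta v) (mu v) (n v) (m v))%:E.
Proof.
move=> nr; pose M := \max_v n v.
have nM v : (n v <= M)%N by exact: leq_bigmax.
pose A v := [set j : 'I_M | (j < n v)%N]%SET.
(* The value outside [S] is fixed, so that the families are those over which [big_distr_big_dep]
   sums. *)
pose g t : {ffun V -> {set 'I_M}} := [ffun v =>
  if v \in S then [set j : 'I_M | (j < n v)%N && I v j t]%SET
  else finset.set0].
set E := [set t | _].
(* The finitely many variables involved are gathered in one map [h] to a countable type, through
   which [g] and [E] factor; this gives measurability. *)
pose U : countType := ({ffun V -> {ffun 'I_M -> bool}} * {ffun V -> nat})%type.
pose h t : U :=
  ([ffun v => [ffun j : 'I_M => I v j t]], [ffun v => L v t]).
have mh x : measurable (h @^-1` [set x]).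
  have -> : h @^-1` [set x] =
      (fun t => [ffun v => [ffun j : 'I_M => I v j t]]) @^-1` [set x.1] `&`
      (fun t => [ffun v => L v t]) @^-1` [set x.2].
    apply/seteqP; split => t /=; first by move=> <-.
    by rewrite /h; case: x => x1 x2 /= [-> ->].
  apply: measurableI; apply: measurable_ffun_fibers => v y.
    apply: measurable_ffun_fibers => j z; exact: measurable_preimage_bool.
  exact: measurable_preimage_nat.
have mg f : measurable (g @^-1` [set f]).
  rewrite [X in measurable X](_ : _ = h @^-1` [set x : U | [ffun v =>
    if v \in S then [set j : 'I_M | (j < n v)%N && x.1 v j]%SET
    else finset.set0] = f]).
    exact: measurable_preimage_fibers.
  apply/seteqP; split => t /= <-; apply/ffunP => v; rewrite !ffunE;
    case: ifP => // _; apply/setP => j; by rewrite !inE !ffunE.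
have mE : measurable E.
  rewrite [X in measurable X](_ : _ = h @^-1` [set x : U | forall v, v \in S ->
    (\sum_(j < n v) x.1 v (widen_ord (nM v) j) + x.2 v)%N = m v]).
    exact: measurable_preimage_fibers.
  apply/seteqP; split => t /= Et v /Et <-; rewrite !ffunE; congr (_ + _)%N;
    by apply: eq_bigr => j _; rewrite !ffunE.
have cardE t v : v \in S -> (\sum_(j < n v) I v j t)%N = #|g t v|.
  move=> vS; rewrite ffunE vS.
  exact: (sum_bool_card (fun j => I v j t)).
have := measure_fibers P setT mE mg; rewrite preimage_setT setIT => ->.
rewrite esum_finType => [|f]; last exact: measure_ge0.
pose Q v (B : {set 'I_M}) := (B \subset A v) && (#|B| <= m v)%N.
rewrite (bigID (mem (pfamily finset.set0 (mem S) Q))) /=.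
rewrite [X in (_ + X)%E]big1 ?adde0; last first.
  move=> f fQ; rewrite (_ : _ `&` _ = set0) ?measure0//.
  apply/seteqP; split => // t [Et gt]; move/negP: fQ; apply.
  rewrite /= in gt; rewrite -gt; apply/pfamilyP; split.
    apply/fintype.subsetP => v; rewrite !inE ffunE; case: ifP => //.
    by rewrite eqxx.
  move=> v vS; rewrite /Q unfold_in -(cardE _ _ vS) -(Et v vS) leq_addr andbT.
  by rewrite ffunE vS; apply/fintype.subsetP => j; rewrite !inE => /andP[].
under [in RHS]eq_bigr do rewrite -(thin_kernel_subsets _ _ _ (nM _)).
rewrite (big_distr_big_dep finset.set0 (mem S) Q) /= -sumEFin.
apply: eq_bigr => f /pfamilyP[fS fQ].
(* Given the success sets, [L v] must supply the rest of [m v]; the bound in [Q] keeps the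
   subtraction from truncating. *)
rewrite -(pattern_law _ (fun v => m v - #|f v|)%N _ nr); congr (P _).
apply/seteqP; split => t /=.
  move=> [Et gt] v vS; split; first by rewrite -gt -cardE// -Et// addKn.
  by move=> j jn; rewrite -gt ffunE vS inE jn.
move=> Ht; have gt : g t = f.
  apply/ffunP => v; rewrite ffunE; case: ifP => vS; last first.
    apply/esym/eqP; move: vS; apply: contraFT => fv.
    by move/fintype.subsetP: fS; apply; rewrite inE.
  have /andP[/fintype.subsetP fA _] := fQ v vS.
  apply/setP => j; rewrite !inE; case: (ltnP j (n v)) => /= jn.
    by have [_ ->] := Ht v vS.
  by apply/esym/negP => /fA; rewrite inE ltnNge jn.
split => // v vS; have [-> _] := Ht v vS.
rewrite cardE// gt subnKC//.
by have /andP[] := fQ v vS.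
Qed.


End blocks.
(** * The joint mass function *)

Section tree_model.
Context (R : realType) (V : finType) (e : rel V).
Hypothesis he : is_tree e.
Variables (lambda : V -> R) (alpha : V -> V -> R).
Hypothesis hlambda : forall v, 0 < lambda v.
Hypothesis halpha_sym : forall u v, e u v -> alpha u v = alpha v u.
Hypothesis halpha : forall u v, e u v ->
  0 < alpha u v <= Num.min (Num.sqrt (lambda u / lambda v))
                           (Num.sqrt (lambda v / lambda u)).

Definition edge_rate (u v : V) : R :=
  alpha u v * Num.sqrt (lambda u * lambda v).

Lemma edge_rateC u v : e u v -> edge_rate u v = edge_rate v u.
Proof. by move=> uv; rewrite /edge_rate halpha_sym// (mulrC (lambda u)). Qed.

Lemma edge_rate_ge0 u v : e u v -> 0 <= edge_rate u v.
Proof.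
by move=> /halpha /andP[a0 _]; rewrite mulr_ge0 ?sqrtr_ge0// ltW.
Qed.

Lemma sqrt_ratioE u v :
  lambda u * Num.sqrt (lambda v / lambda u) = Num.sqrt (lambda u * lambda v).
Proof.
rewrite !sqrtrM ?sqrtrV ?ltW//.
rewrite -{1}(sqr_sqrtr (ltW (hlambda u))); field.
by rewrite gt_eqF// sqrtr_gt0.
Qed.

Lemma rate_thinE u v :
  lambda u * (alpha u v * Num.sqrt (lambda v / lambda u)) = edge_rate u v.
Proof. by rewrite mulrCA sqrt_ratioE. Qed.

Lemma rate_innovationE u v :
  lambda v * (1 - alpha u v * Num.sqrt (lambda u / lambda v)) =
  lambda v - edge_rate u v.
Proof. by rewrite mulrBr mulr1 mulrCA sqrt_ratioE (mulrC (lambda v)). Qed.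

(** Here the upper bound on [alpha] enters. At a parent [u] it makes the thinning parameter at most
    1; its mirror image [edge_rate_le_r] makes the innovation rate nonnegative. *)
Lemma edge_rate_le u v : e u v -> edge_rate u v <= lambda u.
Proof.
move=> /halpha /andP[_]; rewrite le_min => /andP[a1 _].
rewrite -rate_thinE -[leRHS]mulr1 ler_pM2l//.
apply: (le_trans (ler_wpM2r (sqrtr_ge0 _) a1)).
rewrite -sqrtrM; last by rewrite divr_ge0 ?ltW.
have -> : lambda u / lambda v * (lambda v / lambda u) = 1.
  by field; rewrite !gt_eqF.
by rewrite sqrtr1.
Qed.

Lemma edge_rate_le_r u v : e u v -> edge_rate u v <= lambda v.
Proof.
move=> uv; rewrite edge_rateC// edge_rate_le//.
by have [_ sym _ _] := he; rewrite sym.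
Qed.

Definition parent (r v : V) : V := xget r [set u | is_parent e r u v].

Lemma parentE r u v : is_parent e r u v -> parent r v = u.
Proof.
by move=> uv; apply: xget_unique => // w wv; exact: (parent_unique he wv uv).
Qed.

Lemma parentP r v : v != r -> is_parent e r (parent r v) v.
Proof. by move=> /(parent_exists he)[u uv]; rewrite (parentE uv). Qed.

Lemma parent_neq_root r u v : is_parent e r u v -> v != r.
Proof. by move=> uv; apply/eqP => vr; subst v; exact: (root_no_parent uv). Qed.

Lemma edge_parentE r u v :
  e u v = ((v != r) && (u == parent r v)) || ((u != r) && (v == parent r u)).
Proof.
apply/idP/orP => [/(edge_parent he r)[uv|vu]|
                  [/andP[vr /eqP->]|/andP[ur /eqP->]]].
- by left; rewrite (parent_neq_root uv) (parentE uv) eqxx.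
- by right; rewrite (parent_neq_root vu) (parentE vu) eqxx.
- exact: parent_edge (parentP vr).
- have [_ -> _ _] := he; exact: parent_edge (parentP ur).
Qed.

Definition thin_rate r v : R :=
  alpha (parent r v) v * Num.sqrt (lambda v / lambda (parent r v)).

Definition innovation_rate r v : R :=
  if v == r then lambda r else lambda v - edge_rate (parent r v) v.

(* The number to be thinned at [v]: the value [0] at the root makes the root
   obey the same recursion as the other vertices. *)
Definition input r (x : V -> nat) v : nat :=
  if v == r then 0%N else x (parent r v).

Definition vertex_kernel r (x : V -> nat) v : R :=
  thin_kernel (thin_rate r v) (innovation_rate r v) (input r x v) (x v).

Definition joint_pmf r (x : V -> nat) : R := \prod_v vertex_kernel r x v.

(** Density of the law of a pair of neighbours with respect to the product of its Poisson
    marginals. *)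
Definition edge_density (x : V -> nat) u v : R :=
  edge_pmf (edge_rate u v) (lambda u - edge_rate u v)
           (lambda v - edge_rate u v) (x u) (x v) /
  (pois (lambda u) (x u) * pois (lambda v) (x v)).

Lemma edge_density_ge0 x u v : e u v -> 0 <= edge_density x u v.
Proof.
move=> uv; apply: divr_ge0; last first.
  by apply: mulr_ge0; apply: pois_ge0; exact: ltW.
apply: edge_pmf_ge0; first exact: edge_rate_ge0.
  by rewrite subr_ge0; exact: edge_rate_le.
by rewrite subr_ge0; exact: edge_rate_le_r.
Qed.

Lemma edge_densityC x u v : e u v -> edge_density x u v = edge_density x v u.
Proof.
by move=> uv; rewrite /edge_density edge_pmfC (edge_rateC uv) mulrC
  (mulrC (pois (lambda u) _)) mulrC.
Qed.

Lemma parent_kernelE r v m n : v != r ->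
  pois (lambda (parent r v)) m *
    thin_kernel (thin_rate r v) (innovation_rate r v) m n =
  edge_pmf (edge_rate (parent r v) v)
    (lambda (parent r v) - edge_rate (parent r v) v)
    (lambda v - edge_rate (parent r v) v) m n.
Proof.
move=> vr; rewrite /innovation_rate (negPf vr) pois_thin_kernel.
by rewrite /thin_rate rate_thinE.
Qed.

Lemma vertex_kernelE r x v : vertex_kernel r x v =
  pois (lambda v) (x v) *
  (if v == r then 1 else edge_density x (parent r v) v).
Proof.
have p0 u : pois (lambda u) (x u) != 0 by rewrite gt_eqF// pois_gt0.
rewrite /vertex_kernel /input; case: ifP => [/eqP->|/negbT vr].
  rewrite /innovation_rate eqxx mulr1 /thin_kernel min0n big_ord1.
  by rewrite !expr0 bin0 !mul1r subn0.
apply: (mulfI (p0 (parent r v))); rewrite parent_kernelE// /edge_density.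
by field; rewrite !p0.
Qed.

(* The product over the oriented edges [(parent v, v)] is squared so as to range
   over all ordered pairs of adjacent vertices, where the root disappears. *)
Lemma edge_density_square r x :
  (\prod_(v | v != r) edge_density x (parent r v) v) ^+ 2 =
  \prod_v \prod_(u | e u v) edge_density x u v.
Proof.
pose D u v := (v != r) && (u == parent r v).
have DE : \prod_(v | v != r) edge_density x (parent r v) v =
    \prod_v \prod_u (if D u v then edge_density x u v else 1).
  rewrite big_mkcond; apply: eq_bigr => v _; rewrite -big_mkcond /D.
  by case: ifP => vr /=; rewrite ?big_pred0_eq// big_pred1_eq.
rewrite expr2 {1}DE DE [X in _ * X]exchange_big -big_split /=.
apply: eq_bigr => v _; rewrite -big_split [RHS]big_mkcond.
apply: eq_bigr => u _; rewrite (edge_parentE r) -/(D u v) -/(D v u).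
(* An edge is oriented one way only, so exactly one of the two factors contributes at an ordered
   pair of neighbours. *)
have nD : ~~ (D u v && D v u).
  apply/negP => /andP[/andP[vr /eqP uv] /andP[ur /eqP vu]].
  apply: (parent_asym he (parentP vr)); rewrite -uv {1}vu.
  exact: parentP.
case: (boolP (D u v)) nD => [_ /negbTE /= ->|_ _] /=; first by rewrite mulr1.
rewrite mul1r; case: ifP => // vu; apply: edge_densityC.
by rewrite (edge_parentE r) -/(D u v) -/(D v u) vu.
Qed.

Lemma joint_pmf_root r1 r2 x : joint_pmf r1 x = joint_pmf r2 x.
Proof.
have pmfE r : joint_pmf r x = (\prod_v pois (lambda v) (x v)) *
    \prod_(v | v != r) edge_density x (parent r v) v.
  rewrite /joint_pmf [X in _ * X]big_mkcond -big_split; apply: eq_bigr => v _.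
  by rewrite vertex_kernelE; case: ifP.
rewrite !pmfE; congr (_ * _); apply/eqP.
have ge0 r : 0 <= \prod_(v | v != r) edge_density x (parent r v) v.
  apply: prodr_ge0 => v vr; apply: edge_density_ge0.
  exact: parent_edge (parentP vr).
(* Nonnegative numbers with equal squares are equal. *)
by rewrite -(eqrXn2 (n := 2))// !edge_density_square.
Qed.

Definition exchange_at (u : V) (x y : {ffun V -> nat}) : {ffun V -> nat} :=
  [ffun v => if v == u then y v else x v].

(** The identity holds vertex by vertex. If [u] is the vertex or its parent, the other end of the
    edge, if any, is a neighbour of [u], where [x] and [y] agree, so the two factors are unchanged.
    At all other vertices they trade places. *)
Lemma joint_pmf_exchange r u (x y : {ffun V -> nat}) :
  (forall v, e u v -> x v = y v) ->
  joint_pmf r (exchange_at u y x) * joint_pmf r (exchange_at u x y) =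
  joint_pmf r x * joint_pmf r y.
Proof.
move=> xy; have [irr sym _ _] := he.
rewrite /joint_pmf -!big_split /=; apply: eq_bigr => v _.
rewrite /vertex_kernel /input !ffunE.
have [->|vu] := eqVneq v u.
  case: ifP => [_ //|/negbT ur]; rewrite ?ffunE.
  have pu : e u (parent r u) by rewrite sym; exact: parent_edge (parentP ur).
  have [pE|_] := eqVneq (parent r u) u; first by rewrite pE irr in pu.
  by rewrite (xy _ pu).
case: ifP => [_|/negbT vr]; rewrite ?ffunE; first by rewrite mulrC.
have [pE|_] := eqVneq (parent r v) u; last by rewrite mulrC.
by rewrite (xy v)// -pE; exact: parent_edge (parentP vr).
Qed.

End tree_model.
(** * Laws of the rooted construction *)

Section rooted.
Context (R : realType) (V : finType) (e : rel V).
Hypothesis he : is_tree e.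
Variables (lambda : V -> R) (alpha : V -> V -> R).
Hypothesis hlambda : forall v, 0 < lambda v.
Hypothesis halpha_sym : forall u v, e u v -> alpha u v = alpha v u.
Hypothesis halpha : forall u v, e u v ->
  0 < alpha u v <= Num.min (Num.sqrt (lambda u / lambda v))
                           (Num.sqrt (lambda v / lambda u)).
Context (r : V) (d : measure_display) (T : measurableType d).
Context (P : probability T R).
Variables (L : V -> {RV P >-> nat}) (I : V -> nat -> {RV P >-> bool}).
Variable (N : V -> {RV P >-> nat}).
Hypothesis hrc : rooted_construction e lambda alpha r L I N.

Local Notation vertex_kernel := (vertex_kernel e lambda alpha r).
Local Notation joint_pmf := (joint_pmf e lambda alpha r).
Local Notation parent := (parent e r).
Local Notation thin_rate := (thin_rate e lambda alpha r).
Local Notation innovation_rate := (innovation_rate e lambda alpha r).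

Lemma thin_rate_itv v : v != r -> 0 <= thin_rate v <= 1.
Proof.
move=> vr; have pv := parent_edge (parentP he vr).
have /andP[a0 _] := halpha pv.
rewrite mulr_ge0 ?sqrtr_ge0 ?(ltW a0)//=.
rewrite -(ler_pM2l (hlambda (parent v))) rate_thinE// mulr1.
exact: (edge_rate_le hlambda halpha pv).
Qed.

Lemma innovation_law v k :
  P (L v @^-1` [set k]) = (pois (innovation_rate v) k)%:E.
Proof.
rewrite /innovation_rate; case: ifP => [/eqP->|/negbT vr].
  by have := rc_L_root hrc [set k]; rewrite poisson_prob_set1// ltW.
have pv := parentP he vr.
have := rc_L hrc pv [set k]; rewrite rate_innovationE// poisson_prob_set1//.
rewrite subr_ge0.
exact: (edge_rate_le_r he hlambda halpha_sym halpha (parent_edge pv)).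
Qed.

Lemma bernoulli_law v j b : v != r ->
  P (I v j @^-1` [set b]) = (if b then thin_rate v else 1 - thin_rate v)%:E.
Proof.
move=> vr; have := rc_I hrc (parentP he vr) j [set b].
rewrite -/(thin_rate v) /bernoulli_prob thin_rate_itv// fsbig_set1.
by move=> <-; rewrite /distribution /pushforward.
Qed.

(** On a tree, these are the vertex sets of the subtrees that contain the root. *)
Definition parent_closed (S : {set V}) : Prop :=
  r \in S /\ forall v, v \in S -> v != r -> parent v \in S.

(* On a parent-closed set the recursion can be unfolded from the root, so that
   the event [N = x] only involves disjoint blocks of independent variables. *)
Lemma closed_law (S : {set V}) (x : V -> nat) : parent_closed S ->
  P [set t | forall v, v \in S -> N v t = x v] =
  (\prod_(v in S) vertex_kernel x v)%:E.
Proof.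
move=> [rS clS].
rewrite -(block_law (rc_indep hrc) innovation_law bernoulli_law); last first.
  by rewrite /input eqxx.
congr (P _); apply/seteqP; split => t /= Nt.
  move=> v vS; rewrite -(Nt v vS) /input; case: ifP => [/eqP->|/negbT vr].
    by rewrite big_ord0 (rc_N_root hrc).
  by rewrite -(Nt _ (clS v vS vr)) (rc_N hrc (parentP he vr)).
(* Conversely, by induction from the root the number thinned at [v] is the actual value of [N] at
   its parent. *)
apply: (@parent_ind _ _ he r) => [_|u v uv IH vS].
  by have := Nt r rS; rewrite /input eqxx big_ord0 (rc_N_root hrc).
have vr := parent_neq_root uv.
have uS : u \in S by rewrite -(parentE he uv); exact: clS.
rewrite -(Nt v vS) (rc_N hrc uv) /thinning (IH uS).
by rewrite /input (negPf vr) (parentE he uv).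
Qed.

Lemma joint_law (x : {ffun V -> nat}) :
  P (joint N @^-1` [set x]) = (joint_pmf x)%:E.
Proof.
have cT : parent_closed [set: V]%SET by split.
have := closed_law x cT; rewrite (eq_bigl predT) => [<-|v]; last by rewrite inE.
congr (P _); apply/seteqP; split => t /= Nt.
  by move=> v _; rewrite -Nt ffunE.
by apply/ffunP => v; rewrite ffunE; apply: Nt; rewrite inE.
Qed.

Lemma vertex_kernel_ge0 v m n :
  v != r -> 0 <= thin_kernel (thin_rate v) (innovation_rate v) m n.
Proof.
move=> vr; have /andP[t0 t1] := thin_rate_itv vr.
apply: sumr_ge0 => k _; apply: mulr_ge0.
  by rewrite !mulr_ge0 ?exprn_ge0 ?subr_ge0.
apply: pois_ge0; rewrite /innovation_rate (negPf vr) subr_ge0.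
exact: (edge_rate_le_r he hlambda halpha_sym halpha
  (parent_edge (parentP he vr))).
Qed.

Lemma measurable_joint (A : set {ffun V -> nat}) :
  measurable (joint N @^-1` A).
Proof.
apply: measurable_preimage_fibers => x; apply: measurable_ffun_fibers => v y.
exact: measurable_preimage_nat.
Qed.

Lemma joint_esum (A : set {ffun V -> nat}) :
  P (joint N @^-1` A) = \esum_(x in A) (joint_pmf x)%:E.
Proof.
have := measure_fibers P A measurableT
  (fun x => measurable_joint [set x]).
rewrite setTI => ->.
by apply: eq_esum => x _; rewrite setTI -joint_law.
Qed.

Lemma parent_closed_path p : path e r p -> uniq (r :: p) ->
  parent_closed [set w in r :: p]%SET.
Proof.
move=> pp up; split; first by rewrite !inE eqxx.
move=> v; rewrite inE in_cons => /orP[/eqP->|vp vr]; first by rewrite eqxx.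
case/path.splitP: vp pp up => p1 p2; rewrite cat_path -cat_cons cat_uniq.
move=> /andP[pp1 _] /andP[up1 _].
have pv : is_parent e r (last r p1) v by exists p1.
rewrite (parentE he pv) finset.in_set mem_cat -rcons_cons mem_rcons in_cons.
by rewrite mem_last orbT.
Qed.

(** Both sides are summed over the values of [N] on the path from [r] to [u]. This path is
    parent-closed, also with [v] added, and adding [v] multiplies the mass by one kernel. *)
Lemma edge_law u v m n : is_parent e r u v ->
  P (N v @^-1` [set n] `&` N u @^-1` [set m]) =
  ((thin_kernel (thin_rate v) (innovation_rate v) m n)%:E *
   P (N u @^-1` [set m]))%E.
Proof.
move=> uv; have vr := parent_neq_root uv.
have [p [pp up lp]] := uv.
pose S := [set w in r :: p]%SET.
have clS : parent_closed S.
  apply: parent_closed_path; first by move: pp; rewrite rcons_path => /andP[].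
  by move: up; rewrite -rcons_cons rcons_uniq => /andP[].
have uS : u \in S by rewrite finset.in_set lp mem_last.
have vS : v \notin S.
  by move: up; rewrite -rcons_cons rcons_uniq finset.in_set => /andP[].
have clSv : parent_closed (v |: S)%SET.
  split; first by rewrite !inE eqxx orbT.
  move=> w; rewrite in_setU1 => /orP[/eqP-> _|wS wr].
    by rewrite (parentE he uv) in_setU1 uS orbT.
  by rewrite in_setU1 clS.2 ?orbT.
pose g t : {ffun V -> nat} := [ffun w => if w \in S then N w t else 0%N].
have mg x : measurable (g @^-1` [set x]).
  apply: (@measurable_ffun_fibers _ _ V _
    (fun w t => if w \in S then N w t else 0%N)).
  move=> w y; case: (w \in S); first exact: measurable_preimage_nat.
  by rewrite -[X in measurable X]setTI; exact: measurable_cst.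
have gu : N u @^-1` [set m] = g @^-1` [set y | y u = m].
  by apply/seteqP; split => t /=; rewrite ffunE uS.
have := measure_fibers P [set y : {ffun V -> nat} | y u = m] measurableT mg.
rewrite gu setTI => ->.
rewrite measure_fibers//; last exact: measurable_preimage_nat.
rewrite -esumZl; [|exact: vertex_kernel_ge0|by move=> y; exact: measure_ge0].
apply: eq_esum => y /= yu; rewrite setTI.
(* [g] vanishes outside [S], so a [y] that does not has an empty fibre. *)
have [y0|/existsNP[w /not_implyP[wS yw]]] :=
    pselect (forall w, w \notin S -> y w = 0%N); last first.
  have -> : g @^-1` [set y] = set0.
    apply/seteqP; split => // t /= gt; apply: yw.
    by rewrite -gt ffunE (negPf wS).
  by rewrite setI0 measure0 mule0.
have gy : g @^-1` [set y] = [set t | forall w, w \in S -> N w t = y w].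
  apply/seteqP; split => t /=; first by move=> <- w wS; rewrite ffunE wS.
  move=> Nt; apply/ffunP => w; rewrite ffunE; case: ifPn => [/Nt//|].
  by move=> /y0 ->.
pose x w := if w == v then n else y w.
have vE w : w \in S -> (w == v) = false.
  by move=> wS; apply: contraTF wS => /eqP->.
have gx : N v @^-1` [set n] `&` g @^-1` [set y] =
    [set t | forall w, w \in (v |: S)%SET -> N w t = x w].
  rewrite gy; apply/seteqP; split => t /=.
    move=> [Nv Nt] w; rewrite in_setU1 /x; case: eqVneq => [->//|_ /=].
    exact: Nt.
  move=> Nt; split; first by rewrite Nt ?setU11// /x eqxx.
  by move=> w wS; rewrite Nt ?setU1r// /x vE.
rewrite gx closed_law// gy closed_law// big_setU1//= EFinM; congr (_ * _)%E.
  rewrite /vertex_kernel /input (negPf vr) (parentE he uv) /x eqxx.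
  by rewrite vE// yu.
(* The kernels on [S] do not see [v], which is neither in [S] nor a parent of a vertex of [S]. *)
congr EFin; apply: eq_bigr => w wS; rewrite /vertex_kernel /input /x (vE w wS).
by case: ifPn => // wr; rewrite vE//; exact: clS.2.
Qed.

Lemma vertex_law v n : P (N v @^-1` [set n]) = (pois (lambda v) n)%:E.
Proof.
elim/(@parent_ind _ _ he r): v n => [|u v uv IH] n.
  have := rc_L_root hrc [set n]; rewrite poisson_prob_set1; last exact: ltW.
  move=> <-; congr (P _); apply/seteqP.
  by split => t /=; rewrite (rc_N_root hrc).
have vr := parent_neq_root uv; have uve := parent_edge uv.
have := measure_fibers P setT (measurable_preimage_nat (N v) [set n])
  (fun m => measurable_preimage_nat (N u) [set m]).
rewrite preimage_setT setIT => ->.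
pose c := edge_rate lambda alpha u v.
transitivity (\esum_(m in [set: nat])
    (edge_pmf c (lambda u - c) (lambda v - c) m n)%:E).
  apply: eq_esum => m _; have := parent_kernelE e alpha hlambda m n vr.
  by rewrite (parentE he uv) => <-; rewrite EFinM muleC -IH; exact: edge_law.
rewrite esum_edge_pmf; first by rewrite addrC subrK.
- exact: edge_rate_ge0 uve.
- by rewrite subr_ge0; exact: (edge_rate_le hlambda halpha uve).
- by rewrite subr_ge0; exact: (edge_rate_le_r he hlambda halpha_sym halpha uve).
Qed.

Lemma vertex_distribution v (A : set nat) :
  distribution P (N v) A = poisson (lambda v) A.
Proof.
rewrite esum_poisE; last exact: ltW.
have := measure_fibers P A measurableT
  (fun m => measurable_preimage_nat (N v) [set m]).
rewrite setTI /distribution /pushforward => ->.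
by apply: eq_esum => m _; rewrite setTI -vertex_law.
Qed.

Lemma joint_law_fin_num (F : set {ffun V -> nat}) :
  P (joint N @^-1` F) \is a fin_num.
Proof. exact: (fin_num_measure P _ (measurable_joint F)). Qed.

Lemma joint_law_mul (F G : set {ffun V -> nat}) :
  (P (joint N @^-1` F) * P (joint N @^-1` G) =
   \esum_(k in F `*`` (fun=> G)) (joint_pmf k.1 * joint_pmf k.2)%:E)%E.
Proof.
have p0 x : (0 <= (joint_pmf (x : {ffun V -> nat}))%:E)%E.
  by rewrite -joint_law.
transitivity (\esum_(x in F) \esum_(y in G)
    (joint_pmf x * joint_pmf y)%:E)%E; last first.
  by rewrite esum_esum// => x y _ _; rewrite EFinM mule_ge0.
rewrite muleC -(fineK (joint_law_fin_num G)) [X in (_ * X)%E]joint_esum.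
rewrite -esumZl ?fine_ge0//; apply: eq_esum => x _.
rewrite (fineK (joint_law_fin_num G)) joint_esum muleC -esumZl//.
by rewrite -lee_fin.
Qed.

(* Exchanging the values at [u] of two configurations that agree on the
   neighbours of [u] preserves the product of their masses. *)
Lemma joint_law_exchange (u : V) (A : set nat) (F G : set {ffun V -> nat}) :
  (forall x y, F x -> G y -> forall j, e u j -> x j = y j) ->
  (forall x y, F (exchange_at u x y) = F x) ->
  (forall x y, G (exchange_at u x y) = G x) ->
  let FA := [set x : {ffun V -> nat} | A (x u)] in
  (P (joint N @^-1` (FA `&` F)) * P (joint N @^-1` G) =
   P (joint N @^-1` (FA `&` G)) * P (joint N @^-1` F))%E.
Proof.
move=> FG Fex Gex /=; rewrite !joint_law_mul.
(* The pair is swapped too: the first component keeps its value at [u] and takes the rest from the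
   second. So [A] stays with the first component while [F] and [G] change places. *)
pose h (k : {ffun V -> nat} * {ffun V -> nat}) :=
  (exchange_at u k.2 k.1, exchange_at u k.1 k.2).
have hK : involutive h.
  by move=> [x y]; congr pair; apply/ffunP => v; rewrite !ffunE; case: eqP.
rewrite [RHS](reindex_esum
  (([set x : {ffun V -> nat} | A (x u)] `&` F) `*`` (fun=> G)) _ h).
  apply: eq_esum => -[x y] /= [[_ Fx] Gy]; congr EFin.
  by rewrite joint_pmf_exchange// => j /(FG _ _ Fx Gy).
split.
- move=> [x y] [[/= Ax Fx] Gy]; rewrite /h /setXR /= Fex Gex ffunE eqxx.
  by split.
- by move=> x y _ _ /(congr1 h); rewrite !hK.
- move=> [x y] [[/= Ax Gx] Fy]; exists (h (x, y)); last exact: hK.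
  by rewrite /h /setXR /= Fex Gex ffunE eqxx; split.
Qed.

Lemma rooted_MRF : is_MRF e N.
Proof.
move=> u w uw nuw z A B mA mB Pz.
set Z := [set z] in Pz *; set nbr := joint _ in Pz *.
pose FZ := [set x : {ffun V -> nat} | forall j : {j | e u j}, x (val j) = z j].
pose FB := [set x : {ffun V -> nat} | B (x w)] `&` FZ.
have ZE : nbr @^-1` Z = joint N @^-1` FZ.
  apply/seteqP; split => t /=.
    by move=> Nz j; rewrite -Nz !ffunE.
  by move=> H; apply/ffunP => j; rewrite ffunE -H ffunE.
have BE : N w @^-1` B `&` nbr @^-1` Z = joint N @^-1` FB.
  by rewrite ZE; apply/seteqP; split => t; rewrite /FB /= ffunE.
have AE : N u @^-1` A `&` nbr @^-1` Z =
    joint N @^-1` ([set x : {ffun V -> nat} | A (x u)] `&` FZ).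
  by rewrite ZE; apply/seteqP; split => t; rewrite /= ffunE.
have ABE : N u @^-1` A `&` N w @^-1` B `&` nbr @^-1` Z =
    joint N @^-1` ([set x : {ffun V -> nat} | A (x u)] `&` FB).
  by rewrite -setIA BE; apply/seteqP; split => t; rewrite /= ffunE.
have [irr _ _ _] := he.
have FZex x y : FZ (exchange_at u x y) = FZ x.
  have xE (j : {j | e u j}) : exchange_at u x y (val j) = x (val j).
    by rewrite ffunE; case: eqP (valP j) => // ->; rewrite irr.
  by apply/propext; split => H j; rewrite -H xE.
have FBex x y : FB (exchange_at u x y) = FB x.
  by rewrite /FB /setI /= FZex ffunE eq_sym (negPf uw).
have FZ_agree x y : FZ x -> FZ y -> forall j, e u j -> x j = y j.
  by move=> Hx Hy j uj; rewrite (Hx (exist _ j uj)) (Hy (exist _ j uj)).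
have FBZ_agree x y (Fx : FB x) := FZ_agree x y Fx.2.
(* With F = [FB] and G = [FZ] this reads P(A, B, Z) P(Z) = P(A, Z) P(B, Z); dividing by P(Z) squared
   gives the claim. *)
have := joint_law_exchange A FBZ_agree FBex FZex.
rewrite /= -ABE -AE -BE -ZE /cond_prob => /(congr1 fine).
have Pfin F := joint_law_fin_num F.
rewrite !fineM; try by rewrite ?ABE ?AE ?BE ?ZE Pfin.
have : 0 < fine (P (nbr @^-1` Z)).
  by rewrite fine_gt0// Pz /= ltey_eq ZE Pfin.
rewrite lt0r => /andP[k0 _] E.
by rewrite mulrACA -E; field.
Qed.

End rooted.

Theorem theorem2p2 (R : realType) (d : nat) (hd : (1 <= d)%N)
    (e : rel 'I_d) (he : is_tree e)
    (lambda : 'I_d -> R) (hlambda : forall v, 0 < lambda v)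
    (alpha : 'I_d -> 'I_d -> R)
    (halpha_sym : forall u v, e u v -> alpha u v = alpha v u)
    (halpha : forall u v, e u v ->
       0 < alpha u v <=
       Num.min (Num.sqrt (lambda u / lambda v))
               (Num.sqrt (lambda v / lambda u))) :
  (* (1) *)
  (forall (r : 'I_d) (dT : measure_display) (T : measurableType dT)
      (P : probability T R) (L : 'I_d -> {RV P >-> nat})
      (I : 'I_d -> nat -> {RV P >-> bool}) (N : 'I_d -> {RV P >-> nat}),
    rooted_construction e lambda alpha r L I N -> is_MRF e N) /\
  (* (2) *)
  (forall (r1 r2 : 'I_d) (dT1 dT2 : measure_display)
      (T1 : measurableType dT1) (T2 : measurableType dT2)
      (P1 : probability T1 R) (P2 : probability T2 R)
      (L1 : 'I_d -> {RV P1 >-> nat}) (I1 : 'I_d -> nat -> {RV P1 >-> bool})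
      (N1 : 'I_d -> {RV P1 >-> nat})
      (L2 : 'I_d -> {RV P2 >-> nat}) (I2 : 'I_d -> nat -> {RV P2 >-> bool})
      (N2 : 'I_d -> {RV P2 >-> nat}),
    rooted_construction e lambda alpha r1 L1 I1 N1 ->
    rooted_construction e lambda alpha r2 L2 I2 N2 ->
    same_joint_law N1 N2) /\
  (* (3) *)
  (forall (r : 'I_d) (dT : measure_display) (T : measurableType dT)
      (P : probability T R) (L : 'I_d -> {RV P >-> nat})
      (I : 'I_d -> nat -> {RV P >-> bool}) (N : 'I_d -> {RV P >-> nat}),
    rooted_construction e lambda alpha r L I N ->
    forall (v : 'I_d) (A : set nat),
      distribution P (N v) A = poisson (lambda v) A).
Proof.
split; last split.
- move=> r dT T P L I N hrc.
  exact: (rooted_MRF he hlambda halpha_sym halpha hrc).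
- move=> r1 r2 dT1 dT2 T1 T2 P1 P2 L1 I1 N1 L2 I2 N2 hrc1 hrc2 A.
  rewrite (joint_esum he hlambda halpha_sym halpha hrc1).
  rewrite (joint_esum he hlambda halpha_sym halpha hrc2).
  apply: eq_esum => x _; congr EFin.
  exact: (joint_pmf_root he hlambda halpha_sym halpha).
- move=> r dT T P L I N hrc.
  exact: (vertex_distribution he hlambda halpha_sym halpha hrc).
Qed.
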